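(* Let $r,s\ge1$ and let $a_1,\dots,a_r,b_1,\dots,b_s,\alpha,\beta,z\in\mathbb{C}$ satisfy the standing assumption of the context, and assume all series below converge absolutely. Then $$z\,\frac{\prod_{i=1}^r(1-a_i)}{\prod_{j=1}^s(1-b_j)}\;{}_rR_{s,q}(a_1q,\dots,a_rq;b_1q,\dots,b_sq;\alpha,\beta;z)$$ $$=(-q)^{1+s-r}\,{}_rR_{s,q}(a_1,\dots,a_r;b_1,\dots,b_s;\alpha,\beta-\alpha;zq^{r-s-1})-(-q)^{1+s-r}\,{}_rR_{s,q}(a_1,\dots,a_r;b_1,\dots,b_s;\alpha,\beta-\alpha;zq^{r-s}).$$
   Context: Let $q\in\mathbb{C}$, $0<|q|<1$. $(a;q)_0=1$, $(a;q)_n=\prod_{i=0}^{n-1}(1-aq^i)$ for $n\ge1$, $(a;q)_\infty=\prod_{i\ge0}(1-aq^i)$. The $q$-gamma function is $\Gamma_q(x)=\frac{(q;q)_\infty}{(q^x;q)_\infty}(1-q)^{1-x}$ (principal logarithms), and $1/\Gamma_q(x)$ is read as $0$ at its poles. The basic function ${}_rR_{s,q}$ is $${}_rR_{s,q}(a_1,\dots,a_r;b_1,\dots,b_s;\alpha,\beta;z)=\sum_{\ell=0}^\infty\frac{z^\ell(-1)^{(1+s-r)\ell}q^{(1+s-r)\binom{\ell}{2}}}{(q;q)_\ell\,\Gamma_q(\ell\alpha+\beta)}\,\frac{\prod_{i=1}^r(a_i;q)_\ell}{\prod_{j=1}^s(b_j;q)_\ell}.$$ Standing assumption: $a_iq^\ell\ne1$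 and $b_jq^\ell\neq1$ for all $i,j$ and all integers $\ell\ge0$. *)

(* Defs.v *)
From HB Require Import structures.
From mathcomp Require Import all_boot all_order all_algebra.
From mathcomp Require Import complex.
From mathcomp Require Import all_classical all_reals all_analysis.

Set Implicit Arguments.
Unset Strict Implicit.
Unset Printing Implicit Defensive.

Import Order.TTheory GRing.Theory Num.Theory.
Import numFieldNormedType.Exports.

Local Open Scope classical_set_scope.
Local Open Scope ring_scope.
Local Open Scope complex_scope.

Section ComplexPower.
Variable R : realType.
Implicit Types w x : R[i].

Definition cexp w : R[i] :=
  (expR (complex.Re w))%:C * (cos (complex.Im w) +i* sin (complex.Im w)).

(* The modulus `|w| is an element of R[i] with zero imaginary part. *)
Definition cmod w : R := complex.Re `|w|.

(* Principal argument, in ]-pi, pi]; only meaningful for w != 0. *)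
Definition carg w : R :=
  if 0 <= complex.Im w then acos (complex.Re w / cmod w)
  else - acos (complex.Re w / cmod w).

Definition clog w : R[i] := ln (cmod w) +i* carg w.

Definition cpow w x : R[i] := cexp (x * clog w).

End ComplexPower.

Section QSeries.
Variable R : realType.
Variable q : R[i].

Definition qpoch (a : R[i]) (n : nat) : R[i] :=
  \prod_(i < n) (1 - a * q ^+ i).

(* The copy R[i]^o carries the topology given by the modulus. *)
Definition qpoch_inf (a : R[i]) : R[i] :=
  limn (qpoch a : nat -> R[i]^o).

(* The poles are the zeros of the denominator. As 0^-1 = 0 here, qGamma takes
   the value 0 at its poles and hence (qGamma x)^-1 = 0 there too, which is the
   usual reading of the reciprocal of the q-gamma function. *)
Definition qGamma (x : R[i]) : R[i] :=
  qpoch_inf q / qpoch_inf (cpow q x) * cpow (1 - q) (1 - x).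

(* The exponent 1 + s - r is an integer, possibly negative, whence the
   power ^ with int exponent in place of ^+. *)
Definition rRs_term (r s : nat) (a : 'I_r -> R[i]) (b : 'I_s -> R[i])
    (alpha beta z : R[i]) (l : nat) : R[i] :=
  let k : int := 1 + s%:Z - r%:Z in
  (z ^+ l * (-1) ^ (k * l%:Z) * q ^ (k * 'C(l, 2)%:Z))
    / (qpoch q l * qGamma (l%:R * alpha + beta))
  * ((\prod_(i < r) qpoch (a i) l) / (\prod_(j < s) qpoch (b j) l)).

Definition rRs (r s : nat) (a : 'I_r -> R[i]) (b : 'I_s -> R[i])
    (alpha beta z : R[i]) : R[i] :=
  limn (series (rRs_term a b alpha beta z : nat -> R[i]^o)).

Definition rRs_abs_cvg (r s : nat) (a : 'I_r -> R[i]) (b : 'I_s -> R[i])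
    (alpha beta z : R[i]) : Prop :=
  cvgn [normed series (rRs_term a b alpha beta z : nat -> R[i]^o)].

End QSeries.

(* Main.v *)
Require Import Defs.
From HB Require Import structures.
From mathcomp Require Import all_boot all_order all_algebra.
From mathcomp Require Import complex.
From mathcomp Require Import all_classical all_reals all_analysis.
From mathcomp Require Import ring.

(** Write k = 1 + s - r, and let u be the general term of the first series on
    the right, whose argument is z q^(-k).  The second argument is q times the
    first, so the second series has general term q^l u_l, and the right-hand
    side is the sum over l of (-q)^k (1 - q^l) u_l.

    The factor 1 - q^l kills the term l = 0, and for l = m + 1 it cancels the
    last factor of (q;q)_(m+1).  What remains of that term is the m-th term of
    the series on the left times its prefactor: (a;q)_(m+1) = (1 - a)(aq;q)_m
    brings out the products of 1 - a_i and 1 - b_j, the argument of the q-gamma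
    function becomes (m + 1) alpha + (beta - alpha) = m alpha + beta, and by
    binom(m+1, 2) = binom(m, 2) + m the powers of q cancel (lemma [rRs_termS]).

    Summing these identities is legitimate once the three series converge
    ([lim_series_shift]), and absolute convergence of a complex series implies
    its convergence because it does so for the real and imaginary parts
    ([complex_normed_cvg]). *)

Set Implicit Arguments.
Unset Strict Implicit.
Unset Printing Implicit Defensive.

Import Order.TTheory GRing.Theory Num.Theory.
Import numFieldNormedType.Exports.
Local Open Scope ring_scope.
Local Open Scope complex_scope.

Section ComplexSeries.
Variable R : realType.

Lemma cvg_Re (f : nat -> R[i]^o) (l : R[i]^o) :
  (f @ \oo --> l)%classic ->
  ((fun n => complex.Re (f n)) @ \oo --> complex.Re l)%classic.
Proof.
move=> fl; apply/cvgrPdist_lt => e e0.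
have ec0 : 0 < e%:C :> R[i] by rewrite ltcR.
have := [elaborate @cvgr_dist_lt _ _ _ _ _ _ _ fl _ ec0].
apply: filterS => n; rewrite -ltcR; apply: le_lt_trans.
by rewrite -raddfB; exact: normc_ge_Re.
Qed.

Lemma cvg_real_complex (g : nat -> R) (l : R) :
  (g @ \oo --> l)%classic ->
  ((fun n => (g n)%:C : R[i]^o) @ \oo --> (l%:C : R[i]^o))%classic.
Proof.
(* A positive element of R[i] is real, so it is a positive tolerance in R. *)
move=> gl; apply/cvgrPdist_lt => e; rewrite ltcE => /andP[/eqP ei er].
have := [elaborate @cvgr_dist_lt _ _ _ _ _ _ _ gl _ er].
apply: filterS => n h; rewrite -rmorphB normc_def /= expr0n addr0 sqrtr_sqr.
by rewrite ltcE /= ei eqxx.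
Qed.

(** The real and imaginary parts of the terms are dominated by their moduli, so
    both real series converge absolutely, hence converge; the complex series is
    recombined from them. *)
Lemma complex_normed_cvg (u : nat -> R[i]^o) :
  cvgn [normed series u] -> cvgn (series u).
Proof.
(* The moduli are elements of R[i]: comparison with them takes place in R, on
   their real parts. *)
move=> /cvg_Re /cvgP; set nu := (X in cvgn X) => cnu.
have dominated_cvg (f : nat -> R) :
    (forall n, `|f n|%:C <= `|u n| :> R[i]) -> cvgn (series f).
  move=> fu; apply: normed_cvg.
  apply: (@series_le_cvg _ _ (fun n => complex.Re `|u n|)) => [n /=|||] //.
  - by move=> n; have := normr_ge0 (u n); rewrite lecE => /andP[].
  - by move=> n; have := fu n; rewrite lecE => /andP[].
  - rewrite [X in cvgn X](_ : _ = nu) //; apply/funext => n.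
    by rewrite /nu /series /= raddf_sum.
have /dominated_cvg cRe n : `|complex.Re (u n)|%:C <= `|u n| :=
  normc_ge_Re (u n).
have /dominated_cvg cIm n : `|complex.Im (u n)|%:C <= `|u n|.
  have := normc_ge_Re (u n * 'i).
  rewrite ReiNIm normrN normrM [`|'i|]normc_def /= expr0n expr1n add0r.
  by rewrite sqrtr1 mulr1.
have seriesE : series u = (fun n => (series (fun k => complex.Re (u k)) n)%:C
    + 'i * (series (fun k => complex.Im (u k)) n)%:C : R[i]^o).
  apply/funext => n; rewrite /series /= !raddf_sum /= mulr_sumr -big_split /=.
  by apply: eq_bigr => i _; rewrite -complexE.
rewrite seriesE; apply: is_cvgD; first exact: cvgP (cvg_real_complex cRe).
exact: cvgP (@cvgMl_tmp _ _ _ _ _ ('i : R[i]^o) _ (cvg_real_complex cIm)).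
Qed.

End ComplexSeries.

(** As u and v start with the same value, the sum of the first n terms of t
    is, up to the constant factors, that of the first n + 1 terms of u - v. *)
Lemma lim_series_shift (K : numFieldType) (t u v : nat -> K^o) (C c : K) :
  cvgn (series t) -> cvgn (series u) -> cvgn (series v) -> u 0%N = v 0%N ->
  (forall m, c * (u m.+1 - v m.+1) = C * t m) ->
  C * limn (series t) = c * limn (series u) - c * limn (series v).
Proof.
move=> ct cu cv uv0 uvS.
have partial_sums : (fun n => C *: series t n) =
    (fun n => c *: (series u n.+1 - series v n.+1)).
  apply/funext => n; rewrite /series /= !big_nat_recl //= uv0 opprD addrACA.
  rewrite subrr add0r -sumrB !scaler_sumr.
  by apply: eq_bigr => m _; rewrite -[LHS]/(C * t m) -uvS.
rewrite -mulrBr -[LHS]/(C *: limn (series t)) -limZl_tmp //.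
rewrite [X in lim (X @ _)%classic]partial_sums.
by apply: cvg_lim => //; apply: cvgZl_tmp; apply: cvgB; rewrite cvg_shiftS.
Qed.

Section Contiguity.
Variables (R : realType) (q : R[i]).

Lemma qpochS_head (a : R[i]) n :
  qpoch q a n.+1 = (1 - a) * qpoch q (a * q) n.
Proof.
rewrite /qpoch big_ord_recl expr0 mulr1; congr (_ * _).
by apply: eq_bigr => i _; rewrite exprS mulrA.
Qed.

Lemma qpochS_last (a : R[i]) n :
  qpoch q a n.+1 = qpoch q a n * (1 - a * q ^+ n).
Proof. by rewrite /qpoch big_ord_recr. Qed.

Lemma prod_qpochS (n : nat) (a : 'I_n -> R[i]) (m : nat) :
  \prod_(i < n) qpoch q (a i) m.+1 =
  \prod_(i < n) (1 - a i) * \prod_(i < n) qpoch q (a i * q) m.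
Proof. by rewrite -big_split; apply: eq_bigr => i _; exact: qpochS_head. Qed.

Lemma rRs_term_scale r s (a : 'I_r -> R[i]) (b : 'I_s -> R[i])
    (alpha beta z c : R[i]) l :
  rRs_term q a b alpha beta (z * c) l = c ^+ l * rRs_term q a b alpha beta z l.
Proof. by rewrite /rRs_term exprMn; ring. Qed.

(** The termwise form of the contiguity relation.  Only 1 - q^(m+1) and powers
    of -1 and q get cancelled; the inverses of the q-gamma values and of the
    products over the b_j are carried along unchanged, so the identity holds at
    the poles of the q-gamma function too. *)
Lemma rRs_termS r s (a : 'I_r -> R[i]) (b : 'I_s -> R[i])
    (alpha beta z : R[i]) (m : nat) (k := 1 + s%:Z - r%:Z) :
  q != 0 -> q ^+ m.+1 != 1 ->
  (- q) ^ k * (1 - q ^+ m.+1)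
    * rRs_term q a b alpha (beta - alpha) (z * q ^ (- k)) m.+1
  = z * ((\prod_(i < r) (1 - a i)) / (\prod_(j < s) (1 - b j)))
    * rRs_term q (fun i => a i * q) (fun j => b j * q) alpha beta z m.
Proof.
move=> q0 qm1.
have q1 : 1 - q ^+ m.+1 != 0 by rewrite subr_eq0 eq_sym.
have sgn2 : (-1 : R[i]) ^ k * (-1) ^ k = 1.
  by rewrite -exprzMl ?unitrN1 // mulrNN mulr1 exp1rz.
have NqE : (- q) ^ k = (-1) ^ k * q ^ k.
  by rewrite -[- q]mulN1r expfzMl.
have sgnE : (-1 : R[i]) ^ (k * m.+1%:Z) = (-1) ^ k * (-1) ^ (k * m%:Z).
  by rewrite intS mulrDr mulr1 expfzDr ?oppr_eq0 ?oner_eq0.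
have binE : q ^ (k * 'C(m.+1, 2)%:Z) = q ^ (k * 'C(m, 2)%:Z) * (q ^ k) ^+ m.
  rewrite binS bin1 PoszD mulrDr expfzDr //.
  by rewrite -[(q ^ k) ^+ m]/((q ^ k) ^ (m%:Z)) exprz_exp.
have argE : m.+1%:R * alpha + (beta - alpha) = m%:R * alpha + beta.
  by rewrite -natr1; ring.
have qkK : (q ^ (- k)) ^+ m.+1 * (q ^ k) ^+ m.+1 = 1.
  by rewrite -exprMn -expfzDr // addNr expr0z expr1n.
rewrite rRs_term_scale /rRs_term -/k argE sgnE binE NqE !prod_qpochS.
rewrite qpochS_last -exprS !invfM.
(* Collect the three factors that are equal to 1. *)
transitivity (((-1) ^ k * (-1) ^ k) *
  ((1 - q ^+ m.+1) * (1 - q ^+ m.+1)^-1) *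
  ((q ^ (- k)) ^+ m.+1 * (q ^ k) ^+ m.+1) *
  (z * ((\prod_(i < r) (1 - a i)) / (\prod_(j < s) (1 - b j)))
    * rRs_term q (fun i => a i * q) (fun j => b j * q) alpha beta z m)).
  rewrite /rRs_term -/k !invfM ![_ ^+ m.+1]exprS.
  ring.
by rewrite sgn2 divff // qkK !mul1r /rRs_term -/k !invfM.
Qed.

End Contiguity.

Theorem theorem4 (R : realType) (q : R[i]) (r s : nat)
    (a : 'I_r -> R[i]) (b : 'I_s -> R[i]) (alpha beta z : R[i])
    (q_gt0 : 0 < `|q|) (q_lt1 : `|q| < 1)
    (r_ge1 : (1 <= r)%N) (s_ge1 : (1 <= s)%N)
    (a_neq : forall (i : 'I_r) (l : nat), a i * q ^+ l <> 1)
    (b_neq : forall (j : 'I_s) (l : nat), b j * q ^+ l <> 1)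
    (cvg_lhs : rRs_abs_cvg q (fun i => a i * q) (fun j => b j * q)
                 alpha beta z)
    (cvg_rhs1 : rRs_abs_cvg q a b alpha (beta - alpha)
                  (z * q ^ (r%:Z - s%:Z - 1)))
    (cvg_rhs2 : rRs_abs_cvg q a b alpha (beta - alpha)
                  (z * q ^ (r%:Z - s%:Z))) :
  z * ((\prod_(i < r) (1 - a i)) / (\prod_(j < s) (1 - b j)))
    * rRs q (fun i => a i * q) (fun j => b j * q) alpha beta z
  = (- q) ^ (1 + s%:Z - r%:Z)
      * rRs q a b alpha (beta - alpha) (z * q ^ (r%:Z - s%:Z - 1))
    - (- q) ^ (1 + s%:Z - r%:Z)
      * rRs q a b alpha (beta - alpha) (z * q ^ (r%:Z - s%:Z)).
Proof.
set k : int := 1 + s%:Z - r%:Z.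
have q0 : q != 0 by rewrite -normr_gt0.
have qX1 m : q ^+ m.+1 != 1.
  apply/eqP => qm1; have := exprn_ilt1 m.+1 (normr_ge0 q) q_lt1.
  by rewrite -normrX qm1 normr1 ltxx.
have e1 : z * q ^ (r%:Z - s%:Z - 1) = z * q ^ (- k).
  by congr (_ * q ^ _); rewrite /k; ring.
have e2 : z * q ^ (r%:Z - s%:Z) = z * q ^ (- k) * q.
  rewrite -mulrA -[X in _ ^ _ * X]expr1z -expfzDr //.
  by congr (_ * q ^ _); rewrite /k; ring.
rewrite e1 in cvg_rhs1 *; rewrite e2 in cvg_rhs2 *.
rewrite /rRs; set C := z * _.
have shift := lim_series_shift (C := C) (c := (- q) ^ k)
  (complex_normed_cvg cvg_lhs) (complex_normed_cvg cvg_rhs1)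
  (complex_normed_cvg cvg_rhs2).
apply: shift => [|m]; first by rewrite [RHS]rRs_term_scale expr0 mul1r.
(* The term of the second series is q^m.+1 times that of the first. *)
rewrite [X in _ * (_ - X)]rRs_term_scale.
rewrite -{1}[rRs_term _ _ _ _ _ _ _]mul1r -mulrBl mulrA.
exact: rRs_termS.
Qed.
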